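(* Let $\mathcal{U}\subset 2^{\{1,\dots,n\}}$ be an admissible update set and let $u_k$, $k=1,2,\dots$, be a sequence of elements of $\mathcal{U}$. Suppose the index sequence can be partitioned into disjoint intervals $\{k_i,\dots,k_{i+1}-1\}$, $i=1,2,\dots$, with $k_i>k_{i-1}$, such that over each interval $\bigcup_{k\in\{k_i,\dots,k_{i+1}-1\}}u_k=\{1,\dots,n\}$, and suppose $N=\max_j (k_{j+1}-k_j+1)$ is finite. Let $D$ be a $\mathcal{U}$-feasible, compact subset of $\mathbb{R}^n$, let $C=\mathrm{conv}(D)$, and suppose $D$ contains the extreme points of $C$. Let $F_k$, $k=1,2,\dots$, be a sequence of $\mathcal{U}$-separable convex functions, $F_k(z)=\sum_{u\in\mathcal{U}}F_k^{(u)}(z^{[u]})$, where each $F_k^{(u)}:\mathbb{R}^{|u|}\to\mathbb{R}$ is convex with bounded curvature with curvature constant $\mu_F$. Let $\beta>0$ and let $\{z_k\}$ be a sequence of vectors with $z_1\in C$ satisfying $$x_k\in\arg\min_{x\in D}\ \partial F_k(z_k)^T U_{u_k}x,\qquad z_{k+1}=z_k+\beta\,U_{u_k}(x_k-z_k).$$ Suppose that $$\beta\le(1-\gamma)\gamma\min\Big\{\frac{\epsilon'}{N\mu_F\bar{x}_D^2},1\Big\}$$ with $0<\gamma<1$, $\epsilon'>0$, $\bar{x}_D:=\max_{y,z\in\mathrm{conv}(D)}\|y-z\|_2$, and that $$|F_{k+1}(z)-F_k(z)|\le\frac{\gamma_1\gamma}{2N}\beta\epsilon'\quad\text{for all } z\in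 C\text{ and all } k,$$ where $\gamma_1\in(0,\gamma/2)$. Then for all $k_i$ sufficiently large, $$F_{k_i}(z_{k_i})-F_{k_i}(y^*_{k_i})\le\epsilon:=(|\mathcal{U}|+1)\epsilon',$$ where $y_k^*\in\arg\min_{z\in C}F_k(z)$.
   Context: For $x\in\mathbb{R}^n$ and $u\subseteq\{1,\dots,n\}$, $x^{[u]}\in\mathbb{R}^{|u|}$ denotes the vector of the elements of $x$ indexed by $u$, and $U_u:\mathbb{R}^n\to\mathbb{R}^n$ is the map that keeps the elements of its argument indexed by $u$ and sets all other elements to $0$. Admissible update set: let $\bar{\mathcal{U}}\subset 2^{\{1,\dots,n\}}$ be a partition of $\{1,\dots,n\}$. A collection $\mathcal{U}\subset 2^{\{1,\dots,n\}}$ is an admissible update set if, for some such partition, $\mathcal{U}=\bar{\mathcal{U}}$ or $\mathcal{U}$ is $\bar{\mathcal{U}}$ together with the full set $\{1,\dots,n\}$. $\mathcal{U}$-feasible: $D\subset\mathbb{R}^n$ with $C=\mathrm{conv}(D)$ is $\mathcal{U}$-feasible if $z+U_u(x-z)\in C$ for all $z\in C$, $x\in D$, $u\in\mathcal{U}$. $\mathcal{U}$-separable: $h:\mathbb{R}^n\to\mathbb{R}$ is $\mathcal{U}$-separable if $h(z)=\sum_{u\in\mathcal{U}}h^{(u)}(z^{[u]})$ with $h^{(u)}:\mathbb{R}^{|u|}\to\mathbb{R}$. Bounded curvature: a convex function $h$ has bounded curvature on a set $S$ with curvature constant $\mu_h\ge 0$ if $h(z+\delta)-h(z)\le\partial h(z)^T\delta+\mu_h\|\delta\|_2^2$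 for all $z,z+\delta\in S$, where $\partial h(z)$ denotes a (fixed choice of) subgradient of $h$ at $z$ and $\mu_h$ does not depend on $z,\delta$. For $F_k^{(u)}$ the set in question is $\{z^{[u]}:z\in C\}$. A quotient with zero denominator is read as $+\infty$. *)

(* Defs.v *)
From HB Require Import structures.
From mathcomp Require Import all_boot all_order all_algebra.
From mathcomp Require Import all_classical all_reals all_analysis.
Set Implicit Arguments.
Unset Strict Implicit.
Unset Printing Implicit Defensive.
Import Order.TTheory GRing.Theory Num.Theory.
Import numFieldNormedType.Exports.
Local Open Scope classical_set_scope.
Local Open Scope ring_scope.

Definition is_max {d : Order.disp_t} {T : porderType d} (A : set T) (m : T) : Prop :=
  A m /\ ubound A m.

Definition argmin {T : Type} {R : realType} (A : set T) (f : T -> R) : set T :=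
  [set x | A x /\ forall y, A y -> f x <= f y].

Section Vectors.
Context {R : realType}.

Definition dot {m : nat} (x y : 'rV[R]_m) : R := \sum_(i < m) x 0 i * y 0 i.

(* Euclidean norm; the library norm `|x| on row vectors is the sup norm *)
Definition norm2 {m : nat} (x : 'rV[R]_m) : R := Num.sqrt (dot x x).

Definition convex_hull {m : nat} (D : set 'rV[R]_m) : set 'rV[R]_m :=
  smallest (fun A => @convex_set R 'rV[R]_m A) D.

Definition extreme_points {m : nat} (C : set 'rV[R]_m) : set 'rV[R]_m :=
  [set z | C z /\ forall (x y : 'rV[R]_m) (t : R), C x -> C y -> 0 < t < 1 ->
    z = t *: x + (1 - t) *: y -> x = z /\ y = z].

Definition convex {m : nat} (h : 'rV[R]_m -> R) : Prop :=
  @convex_function R 'rV[R]_m setT h.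

Definition subgradient {m : nat} (h : 'rV[R]_m -> R) (z g : 'rV[R]_m) : Prop :=
  forall y, h z + dot g (y - z) <= h y.

Definition subgradient_choice {m : nat} (h : 'rV[R]_m -> R)
    (dh : 'rV[R]_m -> 'rV[R]_m) : Prop :=
  forall z, subgradient h z (dh z).

Definition bounded_curvature {m : nat} (S : set 'rV[R]_m) (h : 'rV[R]_m -> R)
    (dh : 'rV[R]_m -> 'rV[R]_m) (mu : R) : Prop :=
  0 <= mu /\
  forall z delta, S z -> S (z + delta) ->
    h (z + delta) - h z <= dot (dh z) delta + mu * norm2 delta ^+ 2.

Context {n : nat}.

(* x^[u], with the selected coordinates in increasing order *)
Definition subvec (u : {set 'I_n}) (x : 'rV[R]_n) : 'rV[R]_#|u| :=
  \row_(j < #|u|) x 0 (enum_val j).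

Definition keep (u : {set 'I_n}) (x : 'rV[R]_n) : 'rV[R]_n :=
  \row_(j < n) (if j \in u then x 0 j else 0).

Definition feasible (U : {set {set 'I_n}}) (D : set 'rV[R]_n) : Prop :=
  forall z x (u : {set 'I_n}), convex_hull D z -> D x -> u \in U ->
    convex_hull D (z + keep u (x - z)).

Definition separable_as (U : {set {set 'I_n}}) (h : 'rV[R]_n -> R)
    (hu : forall u : {set 'I_n}, 'rV[R]_#|u| -> R) : Prop :=
  forall z, h z = \sum_(u in U) hu u (subvec u z).

End Vectors.

Definition admissible {n : nat} (U : {set {set 'I_n}}) : Prop :=
  exists Ubar : {set {set 'I_n}}, finset.partition Ubar [set: 'I_n]%SET /\
    (U = Ubar \/ U = ([set: 'I_n] |: Ubar)%SET).

(* Indices start at 1, values at 0 are irrelevant.  The intervals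
   {kk i, ..., kk (i+1) - 1}, i >= 1, partition {1, 2, ...}. *)
Definition covering_intervals {n : nat} (u : nat -> {set 'I_n}) (kk : nat -> nat) : Prop :=
  [/\ kk 1%N = 1%N,
      forall i : nat, (1 <= i)%N -> (kk i < kk i.+1)%N
    & forall i : nat, (1 <= i)%N ->
        (\bigcup_(kk i <= k < kk i.+1) u k)%SET = [set: 'I_n]%SET].

(* Main.v *)
Require Import Defs.
From HB Require Import structures.
From mathcomp Require Import all_boot all_order all_algebra.
From mathcomp Require Import all_classical all_reals all_analysis.
From mathcomp Require Import ring lra.
Import Order.TTheory GRing.Theory Num.Theory.
Import numFieldNormedType.Exports.
Local Open Scope classical_set_scope.
Local Open Scope ring_scope.

(* Let C = conv D, X = xD^2 and G_k = - dF_k(z_k) . U_(u_k) (x_k - z_k) >= 0.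
   The minimal face of C containing z_k grows with k and is eventually constant;
   from then on dF_k(z_k) agrees with the smooth derivative of F_k along the step,
   so that the step decreases F_k by beta G_k up to 2 mu beta^2 X.

   Let [a, b) be one of the covering intervals and, for k in [a, b), let S_k be the
   part of u_k not met earlier in the interval.  For y in C the vectors
   d_k = U_(S_k) (y - z_a) are orthogonal and sum to y - z_a, so convexity gives
   F_a(z_a) - F_a(y) <= - sum_k F_a'(z_a; d_k).  As z_k agrees with z_a on S_k and is
   within N beta xD of it, comparing function values at z_k + t d_k, with
   t = min(1, N beta), bounds - F_a'(z_a; d_k) by G_k plus an error; only the k with
   S_k nonempty matter, and there are at most #|U| of them.  Hence, up to
   O(#|U|) eps', the suboptimality at z_a is at most the sum of the G_k over the
   interval, so that over an interval it decreases by a fixed amount whenever it is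
   too large, and otherwise increases very little. *)

(** * Convex sets and hulls in terms of segments *)

Definition segment_closed {R : realType} {m : nat} (C : set 'rV[R]_m) : Prop :=
  forall a b (t : R), C a -> C b -> 0 <= t <= 1 -> C (a + t *: (b - a)).

Section ConvexHull.
Context {R : realType} {m : nat}.
Implicit Types (C D : set 'rV[R]_m).

Lemma convex_setE C : @convex_set R 'rV[R]_m C <-> segment_closed C.
Proof.
have convE (a b : 'rV[R]_m) (t : R) : a + t *: (b - a) = t *: b + (1 - t) *: a.
  by rewrite scalerBr scalerBl scale1r addrCA addrA.
split=> hC.
  move=> a b t Ca Cb /andP[t0 t1].
  have := hC b a (Itv01 t0 t1); rewrite !inE => /(_ Cb Ca).
  by rewrite convE.
move=> a b t; rewrite !inE => Ca Cb.
have := hC b a t%:num Cb Ca; rewrite convE; apply.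
by rewrite ge0 le1.
Qed.

Lemma convex_hull_segment D : segment_closed (convex_hull D).
Proof.
apply/convex_setE => a b t; rewrite !inE => Da Db A [cA DA].
have := cA a b t; rewrite !inE; apply; [exact: Da | exact: Db].
Qed.

Lemma sub_convex_hull D : D `<=` convex_hull D.
Proof. exact: sub_gen_smallest. Qed.

Lemma convex_hull_sub D C : segment_closed C -> D `<=` C -> convex_hull D `<=` C.
Proof. by move=> /convex_setE cC DC; apply: smallest_sub. Qed.

End ConvexHull.

(** * The Euclidean inner product *)

Section Dot.
Context {R : realType} {m : nat}.
Implicit Types (x y z : 'rV[R]_m).

Lemma dotC x y : dot x y = dot y x.
Proof. by apply: eq_bigr => i _; rewrite mulrC. Qed.

Lemma dotDr x y z : dot x (y + z) = dot x y + dot x z.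
Proof. by rewrite -big_split; apply: eq_bigr => i _; rewrite mxE mulrDr. Qed.

Lemma dotZr (a : R) x y : dot x (a *: y) = a * dot x y.
Proof. by rewrite big_distrr; apply: eq_bigr => i _; rewrite mxE mulrCA. Qed.

Lemma dotNr x y : dot x (- y) = - dot x y.
Proof. by rewrite -scaleN1r dotZr mulN1r. Qed.

Lemma dot0r x : dot x 0 = 0.
Proof. by rewrite -(scale0r 0) dotZr mul0r. Qed.

Lemma dot_ge0 x : 0 <= dot x x.
Proof. by apply: sumr_ge0 => i _; rewrite -expr2 sqr_ge0. Qed.

Lemma norm2_sqr x : norm2 x ^+ 2 = dot x x.
Proof. by rewrite sqr_sqrtr ?dot_ge0. Qed.

Lemma dotZZ (a : R) x : dot (a *: x) (a *: x) = a ^+ 2 * dot x x.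
Proof. by rewrite dotZr dotC dotZr mulrA expr2. Qed.

Lemma dot_sqrD x y : dot (x + y) (x + y) = dot x x + 2 * dot x y + dot y y.
Proof. by rewrite dotDr (dotC _ x) (dotC _ y) !dotDr (dotC y x); ring. Qed.

(** The triangle inequality, squared: |x| <= k sqrt c and |y| <= sqrt c. The cross term is bounded
    by expanding |x - k y|^2 >= 0; this is void at k = 0, where x = 0 instead. *)
Lemma dot_sum_le (k : nat) (c : R) x y : 0 <= c ->
  dot x x <= k%:R ^+ 2 * c -> dot y y <= c ->
  dot (x + y) (x + y) <= k.+1%:R ^+ 2 * c.
Proof.
move=> c0.
have sqrD (a : R) : dot (x + a *: y) (x + a *: y)
    = dot x x + 2 * a * dot x y + a ^+ 2 * dot y y.
  by rewrite dot_sqrD dotZZ dotZr mulrA.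
case: k => [|k] hx hy.
  have x0 : x = 0.
    apply/rowP => i; rewrite mxE; apply/eqP; rewrite -sqrf_eq0 expr2.
    have := dot_ge0 x; rewrite le_eqVlt => /orP[/eqP x0|xgt]; last first.
      by have := lt_le_trans xgt hx; rewrite expr0n mul0r ltxx.
    have := psumr_eq0P (fun j _ => sqr_ge0 (x 0 j)) (esym x0).
    by move=> /(_ i isT); rewrite expr2 => ->.
  by rewrite x0 add0r expr1n mul1r.
have := dot_ge0 (x + (- k.+1%:R) *: y); rewrite sqrD.
have := sqrD 1; rewrite scale1r => ->.
have k0 : (0 : R) < k.+1%:R by rewrite ltr0n.
rewrite -(natr1 k.+1).
move: k0 hx; set K : R := k.+1%:R => K0 hx h.
rewrite -(ler_pM2l K0).
have h1 := ler_wpM2l (ltW K0) hy.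
have h2 := ler_wpM2l (ltW K0) h1.
by nra.
Qed.

End Dot.

(** * Replacing blocks of coordinates within a set *)

Definition replace_closed {R : realType} {n : nat} (C : set 'rV[R]_n)
    (S : {set 'I_n}) : Prop :=
  forall a b, C a -> C b -> C (a + keep S (b - a)).

Section Keep.
Context {R : realType} {n : nat}.
Implicit Types (C D : set 'rV[R]_n) (S T : {set 'I_n}) (a b x : 'rV[R]_n).

Lemma keepT x : keep [set: 'I_n]%SET x = x.
Proof. by apply/rowP => j; rewrite !mxE inE. Qed.

Lemma keep_set0 x : keep finset.set0 x = 0.
Proof. by apply/rowP => j; rewrite !mxE inE. Qed.

Lemma keepB S a b : keep S (a - b) = keep S a - keep S b.
Proof. by apply/rowP => j; rewrite !mxE; case: ifP; rewrite ?subr0. Qed.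

Lemma keep_sub S T x : S \subset T -> keep T (keep S x) = keep S x.
Proof.
move=> /fintype.subsetP ST; apply/rowP => j; rewrite !mxE.
by case: ifP => // jT; case: ifP => // /ST; rewrite jT.
Qed.

Lemma keep_setU_setD S T x : keep (S :|: T) x = keep S x + keep (T :\: S) x.
Proof.
apply/rowP => j; rewrite !mxE !inE.
by case: (j \in S); case: (j \in T); rewrite ?addr0 ?add0r.
Qed.

Lemma dot_keepC S a b : dot a (keep S b) = dot (keep S a) b.
Proof.
by apply: eq_bigr => i _; rewrite !mxE; case: ifP; rewrite ?mulr0 ?mul0r.
Qed.

Lemma dot_keep_setD S T a b : dot (keep S a) (keep (T :\: S) b) = 0.
Proof.
apply: big1 => i _; rewrite !mxE !inE.
by case: (i \in S); rewrite ?mulr0 ?mul0r.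
Qed.

Lemma replace_closed0 C : replace_closed C finset.set0.
Proof. by move=> a b Ca _; rewrite keep_set0 addr0. Qed.

(** Take the coordinates in [S] from [b], then those in [T]. *)
Lemma replace_closedU C S T :
  replace_closed C S -> replace_closed C T -> replace_closed C (S :|: T).
Proof.
move=> hS hT a b Ca Cb; have := hT _ _ (hS _ _ Ca Cb) Cb.
congr (C _); apply/rowP => j; rewrite !mxE !inE.
by case: (j \in S); case: (j \in T) => /=; ring.
Qed.

(** Take the coordinates in [S] from [b], then restore those in [T] from [a]. With unions, this
    makes the sets S_k replaceable. *)
Lemma replace_closedD C S T :
  replace_closed C S -> replace_closed C T -> replace_closed C (S :\: T).
Proof.
move=> hS hT a b Ca Cb; have := hT _ _ (hS _ _ Ca Cb) Ca.
congr (C _); apply/rowP => j; rewrite !mxE !inE.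
by case: (j \in S); case: (j \in T) => /=; ring.
Qed.

Lemma replace_closed_bigcup C (r : seq nat) (u : nat -> {set 'I_n}) :
  (forall k, k \in r -> replace_closed C (u k)) ->
  replace_closed C (\bigcup_(k <- r) u k)%SET.
Proof.
move=> hu; rewrite big_seq; elim/big_ind : _ => //.
- exact: replace_closed0.
- by move=> S T; apply: replace_closedU.
Qed.

(** For fixed [a] the admissible [b] form the preimage of the hull under an affine map; it is convex
    and contains [D]. *)
Lemma feasible_replace (U : {set {set 'I_n}}) D S :
  feasible U D -> S \in U -> replace_closed (convex_hull D) S.
Proof.
move=> hD SU a b Ca; move: b.
apply: convex_hull_sub; last by move=> b Db; apply: hD.
move=> b c t hb hc /(convex_hull_segment _ _ _ _ hb hc).
congr (convex_hull D _); apply/rowP => j; rewrite !mxE.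
by case: (j \in S); ring.
Qed.

End Keep.

(** * Separable functions and their block subgradients *)

Section Separable.
Context {R : realType} {n : nat}.
Variables (U : {set {set 'I_n}}).
Implicit Types (d z : 'rV[R]_n) (h : 'rV[R]_n -> R).

(** The linear form assembled from block subgradients. Curvature is assumed for these, so this form,
    not the subgradient of the whole function, serves as the smooth derivative. *)
Definition sep_dot (g : forall v : {set 'I_n}, 'rV[R]_#|v|) d : R :=
  \sum_(v in U) dot (g v) (subvec v d).

Lemma subvecD v d z : subvec v (d + z) = subvec v d + subvec v z.
Proof. by apply/rowP => j; rewrite !mxE. Qed.

Lemma subvecZ v (t : R) d : subvec v (t *: d) = t *: subvec v d.
Proof. by apply/rowP => j; rewrite !mxE. Qed.

Lemma sep_dotD g d z : sep_dot g (d + z) = sep_dot g d + sep_dot g z.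
Proof.
by rewrite -big_split; apply: eq_bigr => v _; rewrite subvecD dotDr.
Qed.

Lemma sep_dotZ g (t : R) d : sep_dot g (t *: d) = t * sep_dot g d.
Proof.
by rewrite big_distrr; apply: eq_bigr => v _; rewrite subvecZ dotZr.
Qed.

(** Only the block of [i] in the partition and the full set can contain [i]. *)
Lemma admissible_degree (i : 'I_n) : admissible U ->
  (#|[set v in U | i \in v]%SET| <= 2)%N.
Proof.
move=> [V [/and3P[_ tV _] hU]].
apply: (@leq_trans #|[set finset.pblock V i; [set: 'I_n]%SET]%SET|); last first.
  by rewrite cards2; case: eqP.
apply: subset_leq_card; apply/fintype.subsetP => v; rewrite !inE => /andP[vU iv].
have [->|vT] := eqVneq v [set: 'I_n]%SET; first by rewrite orbT.
have vV : v \in V by case: hU vU => -> //; rewrite finset.in_setU1 (negPf vT).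
by rewrite orbF (finset.def_pblock tV vV iv) eqxx.
Qed.

(* The factor 2 comes from the full set, which may be in [U] besides a partition. *)
Lemma sum_subvec_le d : admissible U ->
  \sum_(v in U) dot (subvec v d) (subvec v d) <= 2 * dot d d.
Proof.
move=> hU.
have -> : \sum_(v in U) dot (subvec v d) (subvec v d) =
    \sum_(v in U) \sum_(i < n) if i \in v then d 0 i ^+ 2 else 0.
  apply: eq_bigr => v _; rewrite -big_mkcond big_enum_val /=.
  by apply: eq_bigr => i _; rewrite !mxE expr2.
rewrite exchange_big big_distrr; apply: ler_sum => i _ /=.
rewrite -big_mkcondr /= (eq_bigl (fun v => v \in [set v in U | i \in v]%SET)).
  rewrite sumr_const -[leLHS]mulr_natl expr2 ler_wpM2r ?ler_nat ?admissible_degree//.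
  by rewrite -expr2 sqr_ge0.
by move=> v; rewrite inE.
Qed.

Variables (h : 'rV[R]_n -> R).
Variables (hu : forall v : {set 'I_n}, 'rV[R]_#|v| -> R).
Variables (dhu : forall v : {set 'I_n}, 'rV[R]_#|v| -> 'rV[R]_#|v|).
Hypothesis hsep : separable_as U h hu.

Lemma separable_lower z d :
  (forall v, v \in U -> subgradient_choice (hu v) (dhu v)) ->
  h z + sep_dot (fun v => dhu v (subvec v z)) d <= h (z + d).
Proof.
move=> sub; rewrite !hsep -big_split; apply: ler_sum => v vU /=.
have := sub v vU (subvec v z) (subvec v (z + d)).
by rewrite subvecD (addrC (subvec v z)) addrK.
Qed.

Lemma separable_upper (C : set 'rV[R]_n) (mu : R) z d : admissible U ->
  (forall v, v \in U -> bounded_curvature [set subvec v z | z in C] (hu v) (dhu v) mu) ->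
  0 <= mu -> C z -> C (z + d) ->
  h (z + d) <= h z + sep_dot (fun v => dhu v (subvec v z)) d + 2 * mu * dot d d.
Proof.
move=> adm curv mu0 Cz Czd.
apply: (@le_trans _ _ (\sum_(v in U) (hu v (subvec v z) +
    dot (dhu v (subvec v z)) (subvec v d) + mu * dot (subvec v d) (subvec v d)))).
  rewrite hsep; apply: ler_sum => v vU.
  have [_ /(_ (subvec v z) (subvec v d))] := curv v vU.
  rewrite -subvecD norm2_sqr => b.
  have {b} := b (ex_intro2 _ _ z Cz erefl) (ex_intro2 _ _ (z + d) Czd erefl).
  by rewrite lerBlDl addrA.
rewrite !big_split /= -hsep lerD2l -big_distrr /= [2 * mu]mulrC -mulrA.
by rewrite ler_wpM2l ?sum_subvec_le.
Qed.

End Separable.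

(** * Minimal faces and their growth along the iterates *)

Section Faces.
Context {R : realType} {n : nat}.
Variables (C : set 'rV[R]_n).
Hypothesis segC : segment_closed C.
Implicit Types (z d w : 'rV[R]_n).

(* For [C z], the direction space of the minimal face of [C] containing [z]. *)
Definition face_dir z : set 'rV[R]_n :=
  [set d | exists t : R, [/\ 0 < t, C (z + t *: d) & C (z - t *: d)]].

Lemma segment_shrink {z d} {s t : R} : C z -> C (z + t *: d) -> 0 < s <= t ->
  C (z + s *: d).
Proof.
move=> Cz Ct /andP[s0 st]; have t0 := lt_le_trans s0 st.
have := segC _ _ (s / t) Cz Ct; rewrite [z + _ - z]addrAC subrr add0r scalerA.
rewrite divfK ?gt_eqF//; apply.
by rewrite divr_ge0 ?(ltW s0) ?(ltW t0) //= ler_pdivrMr // mul1r.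
Qed.

Lemma segment_sub_shrink {z d} {s t : R} : C z -> C (z - t *: d) -> 0 < s <= t ->
  C (z - s *: d).
Proof.
by rewrite -!scalerN; exact: segment_shrink.
Qed.

Lemma face_dir0 z : C z -> face_dir z 0.
Proof. by move=> Cz; exists 1; rewrite scaler0 addr0 subr0. Qed.

Lemma face_dirZ z d (a : R) : C z -> face_dir z d -> face_dir z (a *: d).
Proof.
move=> Cz; wlog a0 : a d / 0 < a => [IH hd|].
  case: (ltrgtP a 0) => [an|ap|->]; [|exact: IH|by rewrite scale0r; apply: face_dir0].
  rewrite -[a]opprK scaleNr -scalerN; apply: IH; rewrite ?oppr_gt0//.
  by case: hd => t [t0 ? ?]; exists t; rewrite scalerN opprK.
by move=> [t [t0 Cp Cm]]; exists (t / a); rewrite scalerA divfK ?gt_eqF// divr_gt0.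
Qed.

(** For a common step r, the points z +- (r/2)(d + w) are midpoints of z +- r d and z +- r w. *)
Lemma face_dirD z d w : C z -> face_dir z d -> face_dir z w -> face_dir z (d + w).
Proof.
move=> Cz [s [s0 sp sm]] [t [t0 tp tm]].
pose r := Num.min s t.
have r0 : 0 < r by rewrite lt_min s0.
have rs : 0 < r <= s by rewrite r0 ge_min lexx.
have rt : 0 < r <= t by rewrite r0 ge_min lexx orbT.
exists (r / 2); split; first by rewrite divr_gt0.
  have := segC _ _ (1 / 2) (segment_shrink Cz sp rs) (segment_shrink Cz tp rt).
  have -> : z + (r / 2) *: (d + w) = z + r *: d + (1 / 2) *: (z + r *: w - (z + r *: d)).
    by apply/rowP => j; rewrite !mxE; field.
  by apply; lra.
have := segC _ _ (1 / 2) (segment_sub_shrink Cz sm rs) (segment_sub_shrink Cz tm rt).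
have -> : z - (r / 2) *: (d + w) = z - r *: d + (1 / 2) *: (z - r *: w - (z - r *: d)).
  by apply/rowP => j; rewrite !mxE; field.
by apply; lra.
Qed.

(** The homothety with centre [w] and ratio 1 - b sends z to the new point and z +- t d to points of
    [C] around it. *)
Lemma face_dir_mono z w d (b : R) : 0 < b < 1 -> C z -> C w ->
  face_dir z d -> face_dir (z + b *: (w - z)) d.
Proof.
move=> hb Cz Cw [t [t0 tp tm]]; exists ((1 - b) * t); split.
- by rewrite mulr_gt0// subr_gt0; lra.
- have -> : z + b *: (w - z) + ((1 - b) * t) *: d
      = z + t *: d + b *: (w - (z + t *: d)).
    by apply/rowP => j; rewrite !mxE; ring.
  by apply: segC => //; lra.
- have -> : z + b *: (w - z) - ((1 - b) * t) *: d
      = z - t *: d + b *: (w - (z - t *: d)).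
    by apply/rowP => j; rewrite !mxE; ring.
  by apply: segC => //; lra.
Qed.

(** The new point is interior to the segment from z to w, which extends on both sides of it. *)
Lemma face_dir_step z w (b : R) : 0 < b < 1 -> C z -> C w ->
  face_dir (z + b *: (w - z)) (w - z).
Proof.
move=> hb Cz Cw; pose s := Num.min b (1 - b).
have s0 : 0 < s by rewrite lt_min; lra.
have sb : s <= b by rewrite ge_min lexx.
have sb' : s <= 1 - b by rewrite ge_min lexx orbT.
exists s; split => //.
- by rewrite -addrA -scalerDl; apply: segC => //; lra.
- by rewrite -addrA -scalerBl; apply: segC => //; lra.
Qed.

(* The minimal face of an iterate can only grow, and it grows strictly whenever
   the step direction is not already parallel to it. *)
Lemma eventually_face_dir (z w : nat -> 'rV[R]_n) (b : R) : 0 < b < 1 ->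
  (forall k, (1 <= k)%N -> C (z k) /\ C (w k)) ->
  (forall k, (1 <= k)%N -> z k.+1 = z k + b *: (w k - z k)) ->
  exists K : nat, forall k, (1 <= k)%N -> (K <= k)%N ->
    face_dir (z k) (w k - z k).
Proof.
move=> hb Czw zS; apply: contrapT => /forallNP bad.
have bad' K : exists k, [/\ (1 <= k)%N, (K <= k)%N & ~ face_dir (z k) (w k - z k)].
  apply: contrapT => /forallNP h; apply: (bad K) => k k1 Kk.
  by apply: contrapT => hk; apply: (h k).
(* If bad directions recur for ever, the direction spaces contain subspaces of every dimension: each
   bad direction lies outside the current [V] and is added to it. *)
have grow m : exists (k : nat) (V : {vspace 'rV[R]_n}),
    [/\ (1 <= k)%N, (m <= \dim V)%N & forall d, d \in V -> face_dir (z k) d].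
  elim: m => [|m [k [V [k1 mV VC]]]].
    exists 1%N, 0%VS; split=> // d; rewrite memv0 => /eqP ->.
    by apply: face_dir0; case: (Czw 1%N).
  have mono l : forall d, d \in V -> face_dir (z (k + l)%N) d.
    elim: l => [|l IH] d dV; first by rewrite addn0; apply: VC.
    rewrite addnS zS; last by rewrite (leq_trans k1)// leq_addr.
    have [] := Czw (k + l)%N; first by rewrite (leq_trans k1)// leq_addr.
    by move=> *; apply: face_dir_mono => //; apply: IH.
  have [j [j1 kj nj]] := bad' k.
  have [Cz Cw] := Czw j j1.
  have {}mono d : d \in V -> face_dir (z j) d.
    by move=> dV; rewrite -(subnKC kj); apply: mono.
  exists j.+1, (V + <[w j - z j]>)%VS; split=> //.
    have wV : w j - z j \notin V by apply/negP => /mono.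
    rewrite dimv_disjoint_sum.
      rewrite dim_vline; case: eqP wV => [->|_ _]; first by rewrite mem0v.
      by rewrite addn1.
    apply/eqP; rewrite -subv0; apply/subvP => d.
    rewrite memv_cap => /andP[dV /vlineP[a da]].
    rewrite memv0; move: dV; rewrite da; have [->|a0] := eqVneq a 0.
      by rewrite scale0r eqxx.
    by move=> /(memvZ a^-1); rewrite scalerA mulVf// scale1r (negPf wV).
  move=> d /memv_addP[d1 d1V [_ /vlineP[a ->] ->]].
  have Cz1 : C (z j.+1) by rewrite zS//; apply: segC => //; lra.
  apply: face_dirD => //.
    by rewrite zS//; apply: face_dir_mono => //; apply: mono.
  by apply: face_dirZ => //; rewrite zS//; apply: face_dir_step.
have [k [V [_ dV _]]] := grow (\dim {: 'rV[R]_n}).+1.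
by have := leq_trans dV (dimvS (subvf V)); rewrite ltnn.
Qed.

End Faces.

(** * Derivatives against subgradients *)

(* [l] is the derivative of [F0] at [z]; the two perturbations of the base point,
   [w - z] and [t *: d], are orthogonal, so the curvature error has no cross term. *)
Lemma subgradient_transfer {R : realType} {n : nat} (F0 F1 l : 'rV[R]_n -> R)
    (M e t : R) (g z w d : 'rV[R]_n) :
  {morph l : a b / a + b} -> (forall s a, l (s *: a) = s * l a) ->
  dot (w - z) d = 0 ->
  F0 z + l (w - z) <= F0 w ->
  F0 (w + t *: d) <= F0 z + l (w + t *: d - z)
    + M * dot (w + t *: d - z) (w + t *: d - z) ->
  F1 w + dot g (t *: d) <= F1 (w + t *: d) ->
  `|F1 w - F0 w| <= e -> `|F1 (w + t *: d) - F0 (w + t *: d)| <= e ->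
  t * - l d <= t * - dot g d + M * (dot (w - z) (w - z) + t ^+ 2 * dot d d) + 2 * e.
Proof.
move=> lD lZ orth low up sub; rewrite !ler_norml => /andP[e1 e2] /andP[e3 e4].
have wtE : w + t *: d - z = (w - z) + t *: d by rewrite addrAC.
have sqE : dot (w + t *: d - z) (w + t *: d - z) = dot (w - z) (w - z) + t ^+ 2 * dot d d.
  by rewrite wtE dot_sqrD dotZZ dotZr orth !mulr0 addr0.
move: low up sub; rewrite sqE wtE (lD (w - z)) lZ dotZr; lra.
Qed.

(* Bounded curvature is assumed for one choice of subgradients only.  At a kink on
   the boundary of [C] the algorithm may use another subgradient [g] and move
   uphill; this cannot happen along directions [d] feasible in both senses. *)
Lemma derivative_le_subgradient {R : realType} {n : nat} (C : set 'rV[R]_n)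
    (F l : 'rV[R]_n -> R) (M : R) (g z d : 'rV[R]_n) :
  segment_closed C -> C z -> face_dir C z d -> 0 <= M ->
  (forall s a, l (s *: a) = s * l a) ->
  (forall a, C (z + a) -> F (z + a) <= F z + l a + M * dot a a) ->
  (forall y, F z + dot g (y - z) <= F y) ->
  l d <= dot g d.
Proof.
move=> segC Cz [t [t0 _ Cm]] M0 lZ up sub.
apply/ler_addgt0Pl => e e0.
pose c := M * dot d d.
have c0 : 0 <= c by rewrite mulr_ge0 ?dot_ge0.
(* Small enough for the curvature error per unit step, s c, to be at most e; the + 1 covers c =
   0. *)
pose s := Num.min t (e / (c + 1)).
have s0 : 0 < s by rewrite lt_min t0 divr_gt0// ltr_pwDr.
have st : 0 < s <= t by rewrite s0 ge_min lexx.
have se : s * c <= e.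
  have : s * (c + 1) <= e by rewrite -ler_pdivlMr ?ltr_pwDr// ge_min lexx orbT.
  by rewrite mulrDr mulr1; lra.
(* Moving backwards, F z - s g.d <= F (z - s d) <= F z - s l(d) + s^2 c; division by s gives the
   claim up to e. *)
have := segment_sub_shrink C segC Cz Cm st; rewrite -scaleNr => Cs.
have := up _ Cs; have := sub (z + - s *: d).
rewrite (addrC z) addrK dotZr lZ dotZZ => h1 h2.
rewrite -(ler_pM2l s0); have := ler_wpM2l (ltW s0) se.
by rewrite /c; nra.
Qed.

(** * A scalar recursion, the step size and the interval indices *)

(** The threshold [I] is uniform in [y], as is required for minimizers that change with [i]. *)
Lemma eventually_le_of_descent {R : realType} {T : Type} (P : set T)
    (h : nat -> T -> R) (s : nat -> R) (b q r e : R) (i0 : nat) :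
  0 < b -> 0 <= q -> 0 < e -> (forall i, (i0 <= i)%N -> 0 <= s i) ->
  (forall i y, (i0 <= i)%N -> P y -> h i.+1 y <= h i y - b * s i + b * q) ->
  (forall i y, (i0 <= i)%N -> P y -> h i y <= s i + r) ->
  exists I : nat, forall i y, (I <= i)%N -> P y -> h i y <= (1 + b) * q + e + r.
Proof.
move=> b0 q0 e0 s0 desc bound.
set c := (1 + b) * q + e + r.
(* If s i <= q + e, then h i <= q + e + r and one step leaves h below c; otherwise h drops by at
   least b e. *)
have step B i : (i0 <= i)%N -> (forall y, P y -> h i y <= B) ->
    forall y, P y -> h i.+1 y <= Num.max c (B - b * e).
  move=> ii hB y Py; rewrite le_max; apply/orP.
  have dy := desc i y ii Py.
  have [sle|slt] := leP (s i) (q + e).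
    left; have := bound i y ii Py; have := mulr_ge0 (ltW b0) (s0 i ii).
    by rewrite /c; lra.
  right; have := hB y Py; have : b * (q + e) <= b * s i by rewrite ler_wpM2l ?ltW.
  by lra.
pose B0 := s i0 + r.
have iter j y : P y -> h (i0 + j)%N y <= Num.max c (B0 - j%:R * (b * e)).
  elim: j y => [|j IH] y Py.
    by rewrite addn0 mul0r subr0 le_max bound ?orbT.
  rewrite addnS; apply: le_trans (step _ _ (leq_addr _ _) IH y Py) _.
  rewrite ge_max le_max lexx /= -natr1 mulrDl mul1r.
  have be := mulr_gt0 b0 e0.
  by case: (leP c (B0 - j%:R * (b * e))) => hc; rewrite le_max;
    apply/orP; [right | left]; lra.
have be := mulr_gt0 b0 e0.
pose J := (Num.truncn (`|B0 - c| / (b * e))).+1.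
have hJ : `|B0 - c| <= J%:R * (b * e).
  by rewrite -ler_pdivrMr// ltW// truncnS_gt.
exists (i0 + J)%N => i y Ji Py.
have i0i : (i0 <= i)%N by rewrite (leq_trans _ Ji)// leq_addr.
have := iter (i - i0)%N y Py; rewrite subnKC// => /le_trans; apply.
rewrite ge_max lexx /=.
have Jle : J%:R * (b * e) <= (i - i0)%:R * (b * e).
  by rewrite ler_wpM2r ?(ltW be)// ler_nat leq_subRL.
have := ler_norm (B0 - c); lra.
Qed.

(** For p = 0 the quotient is +oo and the minimum is 1, so that the second bound is just 0 <= c
    eps. *)
Lemma step_size_bounds {R : realType} (beta c p eps : R) : 0 <= c -> 0 < eps -> 0 <= p ->
  (beta%:E <= c%:E * Order.min (eps%:E / p%:E) 1)%E ->
  beta <= c /\ beta * p <= c * eps.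
Proof.
move=> c0 e0; rewrite le_eqVlt => /orP[/eqP <-|p0].
  rewrite inve0 gt0_muley ?lte_fin// min_r ?leey// mule1 lee_fin => bc.
  by rewrite mulr0 mulr_ge0// ltW.
rewrite inver gt_eqF// -EFinM -EFin_min -EFinM lee_fin => hb.
split; first by apply: le_trans hb _; rewrite -[leRHS]mulr1 ler_wpM2l// ge_min lexx orbT.
apply: le_trans (ler_wpM2r (ltW p0) hb) _.
by rewrite -mulrA ler_wpM2l// -ler_pdivlMr// ge_min lexx.
Qed.

Lemma covering_intervals_lt {n : nat} (u : nat -> {set 'I_n}) kk i j :
  covering_intervals u kk -> (1 <= i)%N -> (i < j)%N -> (kk i < kk j)%N.
Proof.
move=> [_ kkS _] i1; elim: j => // j IH; rewrite ltnS leq_eqVlt => /orP[/eqP <-|ij].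
  exact: kkS.
by apply: ltn_trans (IH ij) (kkS _ _); apply: leq_trans (ltnW ij).
Qed.

Lemma covering_intervals_ge {n : nat} (u : nat -> {set 'I_n}) kk i :
  covering_intervals u kk -> (1 <= i)%N -> (i <= kk i)%N.
Proof.
move=> [kk1 kkS _]; elim: i => // -[|i] IH _; first by rewrite kk1.
by apply: leq_ltn_trans (IH isT) (kkS _ _).
Qed.

(** * The block-coordinate iteration *)

Section Iteration.
Context {R : realType} {n : nat}.
Variables (C : set 'rV[R]_n) (X : R) (u : nat -> {set 'I_n}).
(** [L k a] plays the derivative of [F k] at [a], and [g k] the subgradient used by the algorithm at
    [z k]; the two may differ at kinks. *)
Variables (F : nat -> 'rV[R]_n -> R) (L : nat -> 'rV[R]_n -> 'rV[R]_n -> R).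
Variables (g x z : nat -> 'rV[R]_n) (beta M v : R).

Hypothesis segC : segment_closed C.
Hypothesis diamC : forall a b, C a -> C b -> dot (a - b) (a - b) <= X.
Hypothesis replC : forall k, (1 <= k)%N -> replace_closed C (u k).
Hypothesis LD : forall k a, {morph L k a : b c / b + c}.
Hypothesis LZ : forall k a s (b : 'rV[R]_n), L k a (s *: b) = s * L k a b.
Hypothesis lowF : forall k a b, (1 <= k)%N -> F k a + L k a b <= F k (a + b).
Hypothesis upF : forall k (a b : 'rV[R]_n), (1 <= k)%N -> C a -> C (a + b) ->
  F k (a + b) <= F k a + L k a b + M * dot b b.
Hypothesis M0 : 0 <= M.
Hypothesis v0 : 0 <= v.
Hypothesis varF : forall k y, (1 <= k)%N -> C y -> `|F k.+1 y - F k y| <= v.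
Hypothesis subg : forall k (y : 'rV[R]_n), (1 <= k)%N ->
  F k (z k) + dot (g k) (y - z k) <= F k y.
Hypothesis beta01 : 0 < beta < 1.
Hypothesis Cz1 : C (z 1%N).
Hypothesis Cx : forall k, (1 <= k)%N -> C (x k).
Hypothesis minx : forall k y, (1 <= k)%N -> C y ->
  dot (g k) (keep (u k) (x k)) <= dot (g k) (keep (u k) y).
Hypothesis zS : forall k, (1 <= k)%N ->
  z k.+1 = z k + beta *: keep (u k) (x k - z k).

Definition step_dir k := keep (u k) (x k - z k).

(** G_k above, the Frank-Wolfe gap of the block [u k]. *)
Definition fw_gap k : R := - dot (g k) (step_dir k).

(* The set S_k above. *)
Definition fresh a k : {set 'I_n} := (u k :\: \bigcup_(a <= j < k) u j)%SET.

Lemma iterate_mem k : (1 <= k)%N -> C (z k).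
Proof.
elim: k => // -[|k] IH _ //; have Cz := IH isT; rewrite zS//.
have := segC _ _ beta Cz (replC k.+1 isT _ _ Cz (Cx k.+1 isT)).
rewrite [_ + _ - _]addrAC subrr add0r; apply.
by case/andP: beta01 => /ltW-> /ltW->.
Qed.

Lemma fw_gap_ge k y : (1 <= k)%N -> C y -> - dot (g k) (keep (u k) (y - z k)) <= fw_gap k.
Proof.
move=> k1 Cy; rewrite lerN2 /step_dir !keepB !dotDr lerD2r.
exact: minx.
Qed.

Lemma fw_gap_ge0 k : (1 <= k)%N -> 0 <= fw_gap k.
Proof.
move=> k1; have := fw_gap_ge k _ k1 (iterate_mem k k1).
by rewrite keepB subrr dot0r oppr0.
Qed.

Lemma step_dir_le k : (1 <= k)%N -> dot (step_dir k) (step_dir k) <= X.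
Proof.
move=> k1; have Cz := iterate_mem k k1.
have := diamC _ _ (replC k k1 _ _ Cz (Cx k k1)) Cz.
by rewrite [_ + _ - _]addrAC subrr add0r.
Qed.

(** Of the two [v], one pays for changing the function at the new iterate, the other at [y]. *)
Lemma eventual_descent : exists K : nat, forall k y, (1 <= k)%N -> (K <= k)%N -> C y ->
  F k.+1 (z k.+1) - F k.+1 y <=
  F k (z k) - F k y - beta * fw_gap k + (M * beta ^+ 2 * X + 2 * v).
Proof.
(* The target points are [z k] with the block [u k] replaced by that of [x k]; they lie in [C]. *)
have [||K hK] := eventually_face_dir C segC z (fun k => z k + step_dir k) beta beta01.
- move=> k k1; split; first exact: iterate_mem.
  by apply: replC => //; [exact: iterate_mem | exact: Cx].
- by move=> k k1; rewrite zS// [_ + _ - _]addrAC subrr add0r.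
exists K => k y k1 Kk Cy.
have Cz := iterate_mem k k1; have CzS := iterate_mem k.+1 isT.
have dir := hK k k1 Kk; rewrite [_ + _ - _]addrAC subrr add0r in dir.
have der : L k (z k) (step_dir k) <= - fw_gap k.
  rewrite opprK; apply: (derivative_le_subgradient C (F k) _ M _ (z k)) => //.
  - by move=> a; apply: upF.
  - by move=> a; apply: subg.
have := upF k (z k) (beta *: step_dir k) k1 Cz.
rewrite -zS// => /(_ CzS); rewrite LZ dotZZ.
have := varF k _ k1 CzS; have := varF k _ k1 Cy.
rewrite !ler_norml => /andP[v1 v2] /andP[v3 v4] up.
have b0 : 0 <= beta by case/andP: beta01 => /ltW.
have := ler_wpM2l b0 der.
have := ler_wpM2l (mulr_ge0 M0 (sqr_ge0 beta)) (step_dir_le k k1).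
rewrite mulrN -!mulrA; lra.
Qed.

Lemma drift a j : (1 <= a)%N ->
  dot (z (a + j)%N - z a) (z (a + j)%N - z a) <= j%:R ^+ 2 * (beta ^+ 2 * X).
Proof.
move=> a1; elim: j => [|j IH].
  by rewrite addn0 subrr dot0r expr0n mul0r.
have aj1 : (1 <= a + j)%N by rewrite (leq_trans a1)// leq_addr.
rewrite addnS zS// addrAC; apply: dot_sum_le => //.
  by rewrite mulr_ge0 ?sqr_ge0//; apply: le_trans (step_dir_le a a1); apply: dot_ge0.
by rewrite dotZZ ler_wpM2l ?sqr_ge0 ?step_dir_le.
Qed.

Lemma var_iter a j y : (1 <= a)%N -> C y -> `|F (a + j)%N y - F a y| <= j%:R * v.
Proof.
move=> a1 Cy; elim: j => [|j IH]; first by rewrite addn0 subrr normr0 mul0r.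
have aj1 : (1 <= a + j)%N by rewrite (leq_trans a1)// leq_addr.
rewrite addnS -(subrKA (F (a + j)%N y)) -natr1 mulrDl mul1r addrC.
by apply: le_trans (ler_normD _ _) _; rewrite lerD// varF.
Qed.

(** No step from [a] up to [k] has touched a fresh coordinate. *)
Lemma keep_drift a k : (1 <= a)%N -> (a <= k)%N ->
  keep (fresh a k) (z k - z a) = 0.
Proof.
move=> a1 ak; suff h : forall j i, i \notin (\bigcup_(a <= l < a + j) u l)%SET ->
    z (a + j)%N 0 i = z a 0 i.
  apply/rowP => i; rewrite !mxE !inE; case: ifP => // /andP[iu _].
  by have := h (k - a)%N i; rewrite subnKC// => ->//; rewrite subrr.
elim=> [|j IH] i; first by rewrite addn0.
rewrite addnS big_nat_recr ?leq_addr//= inE negb_or => /andP[iz iu].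
rewrite zS; last by rewrite (leq_trans a1)// leq_addr.
by rewrite !mxE (negPf iu) mulr0 addr0 IH.
Qed.

Lemma replace_fresh a k : (1 <= a)%N -> (a <= k)%N -> replace_closed C (fresh a k).
Proof.
move=> a1 ak; apply: replace_closedD; first by apply: replC; apply: leq_trans ak.
apply: replace_closed_bigcup => j; rewrite mem_index_iota => /andP[aj _].
by apply: replC; apply: leq_trans aj.
Qed.

Lemma sum_fresh a b (y : 'rV[R]_n) : (a <= b)%N ->
  \sum_(a <= k < b) keep (fresh a k) y = keep (\bigcup_(a <= k < b) u k)%SET y.
Proof.
elim: b => [|b IH]; first by rewrite leqn0 => /eqP ->; rewrite !big_geq ?keep_set0.
rewrite leq_eqVlt => /orP[/eqP ->|ab]; first by rewrite !big_geq ?keep_set0.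
by rewrite !big_nat_recr//= IH// keep_setU_setD.
Qed.

(** Pythagoras: the fresh sets are disjoint with the same union as the [u k]. *)
Lemma sum_dot_fresh a b (y : 'rV[R]_n) : (a <= b)%N ->
  \sum_(a <= k < b) dot (keep (fresh a k) y) (keep (fresh a k) y)
  = dot (keep (\bigcup_(a <= k < b) u k)%SET y) (keep (\bigcup_(a <= k < b) u k)%SET y).
Proof.
elim: b => [|b IH].
  by rewrite leqn0 => /eqP ->; rewrite !big_geq ?keep_set0 ?dot0r.
rewrite leq_eqVlt => /orP[/eqP ->|ab].
  by rewrite !big_geq ?keep_set0 ?dot0r.
rewrite !big_nat_recr//= IH// keep_setU_setD dot_sqrD.
by rewrite dot_keep_setD mulr0 addr0.
Qed.

(* A set used twice contributes fresh coordinates only the first time. *)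
Lemma count_fresh (U : {set {set 'I_n}}) a b : (1 <= a)%N ->
  (forall k, (1 <= k)%N -> u k \in U) ->
  (\sum_(a <= k < b) (fresh a k != finset.set0) <= #|U|)%N.
Proof.
move=> a1 uU; rewrite -big_mkcond /= sum1_count -size_filter -(size_map u).
rewrite cardE; apply: uniq_leq_size.
  rewrite map_inj_in_uniq ?filter_uniq ?iota_uniq// => j k.
  wlog jk : j k / (j < k)%N => [IH hj hk e|].
    by case: (ltngtP j k) => // jk; [apply: IH | symmetry; apply: IH].
  rewrite !mem_filter !mem_index_iota => /and3P[_ aj jb] /and3P[nk ak kb] e.
  move: nk; rewrite /fresh -e; case/eqP.
  apply/eqP; rewrite finset.setD_eq0; apply/fintype.subsetP => i iu.
  by rewrite (big_rem j) ?mem_index_iota ?aj//= inE iu.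
move=> S /mapP[k]; rewrite mem_filter mem_index_iota => /and3P[_ ak _] ->.
by rewrite mem_enum uU// (leq_trans a1).
Qed.

(** A difference quotient of step t along d_k: the drift contributes at most M t^2 X / t, the change
    from F_a to F_k enters at both ends. If the fresh set is empty, d_k = 0 and no error arises,
    whence the indicator. *)
Lemma fresh_gap a k y t : (1 <= a)%N -> (a <= k)%N -> C y -> 0 < t <= 1 ->
  dot (z k - z a) (z k - z a) <= t ^+ 2 * X ->
  - L a (z a) (keep (fresh a k) (y - z a)) <= fw_gap k
    + (fresh a k != finset.set0)%:R * (M * t * X + 2 * ((k - a)%:R * v) / t)
    + M * t * dot (keep (fresh a k) (y - z a)) (keep (fresh a k) (y - z a)).
Proof.
move=> a1 ak Cy /andP[t0 t1] dist; have k1 := leq_trans a1 ak.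
have [->|_] := eqVneq (fresh a k) finset.set0.
  rewrite keep_set0 -[X in L _ _ X](scale0r 0) LZ dot0r mulr0 /= !mul0r oppr0 !addr0.
  exact: fw_gap_ge0.
have Ca := iterate_mem a a1; have Ck := iterate_mem k k1.
rewrite /= mul1r; set d := keep _ _.
(* As [z k] and [z a] agree on the fresh set, d also leads from [z k] to a point of [C]. *)
have dE : keep (fresh a k) (y - z k) = d.
  have -> : y - z k = (y - z a) - (z k - z a) by rewrite opprB subrKA.
  by rewrite keepB keep_drift// subr0.
have Cd : C (z k + d) by rewrite -dE; apply: replace_fresh.
have Ctd : C (z k + t *: d).
  have := segC _ _ t Ck Cd; rewrite [_ + _ - _]addrAC subrr add0r; apply.
  by rewrite (ltW t0).
have gd : - dot (g k) d <= fw_gap k.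
  have := fw_gap_ge k _ k1 Cd; rewrite [_ + _ - _]addrAC subrr add0r keep_sub//.
  by apply/fintype.subsetP => i; rewrite !inE => /andP[].
have orth : dot (z k - z a) d = 0 by rewrite dot_keepC keep_drift// dotC dot0r.
have var y' := var_iter a (k - a) y' a1; rewrite subnKC// in var.
have := subgradient_transfer (F a) (F k) (L a (z a)) M _ t (g k) (z a) (z k) d
  (LD a (z a)) (LZ a (z a)) orth.
have := lowF a (z a) (z k - z a) a1; rewrite [z a + _]addrC subrK => low.
have := upF a (z a) (z k + t *: d - z a) a1 Ca; rewrite [z a + _]addrC subrK => /(_ Ctd) up.
have := subg k (z k + t *: d) k1; rewrite [_ + _ - _]addrAC subrr add0r => sub.
move=> /(_ _ low up sub (var _ Ck) (var _ Ctd)) main.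
rewrite -(ler_pM2l t0) !mulrDr.
have -> : t * (2 * ((k - a)%:R * v) / t) = 2 * ((k - a)%:R * v).
  by rewrite mulrC divfK ?gt_eqF.
have := ler_wpM2l M0 dist; have := ler_wpM2l (ltW t0) gd.
move: main; nra.
Qed.

Lemma interval_gap (U : {set {set 'I_n}}) a b y (N : nat) (t : R) :
  (1 <= a)%N -> (a <= b)%N -> (b - a <= N)%N -> (0 < N)%N ->
  (forall k, (1 <= k)%N -> u k \in U) ->
  (\bigcup_(a <= k < b) u k)%SET = [set: 'I_n]%SET -> C y ->
  t = Num.min 1 (N%:R * beta) ->
  F a (z a) - F a y <= \sum_(a <= k < b) fw_gap k
    + #|U|%:R * (M * t * X + 2 * (N%:R * v) / t) + M * t * X.
Proof.
move=> a1 ab bN N0 uU cover Cy tE.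
have /andP[b0 _] := beta01.
have X0 : 0 <= X by apply: le_trans (step_dir_le a a1); apply: dot_ge0.
have t0 : 0 < t by rewrite tE lt_min ltr01 mulr_gt0 ?ltr0n.
have t1 : t <= 1 by rewrite tE ge_min lexx.
have Ca := iterate_mem a a1.
(* The 1 in t comes from the diameter, the N beta from the drift. *)
have dist k : (a <= k < b)%N -> dot (z k - z a) (z k - z a) <= t ^+ 2 * X.
  move=> /andP[ak kb]; rewrite tE; case: (leP 1 (N%:R * beta)) => _.
    by rewrite expr1n mul1r; apply: diamC => //; apply: iterate_mem; apply: leq_trans ak.
  have := drift a (k - a) a1; rewrite subnKC// => /le_trans; apply.
  rewrite mulrA exprMn; apply: ler_wpM2r => //; apply: ler_wpM2r; first exact: sqr_ge0.
  rewrite lerXn2r ?nnegrE ?ler0n// ler_nat (leq_trans _ bN)// leq_sub2r//.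
  exact: ltnW.
have L0 : L a (z a) 0 = 0 by rewrite -(scale0r 0) LZ mul0r.
have low := lowF a (z a) (y - z a) a1; rewrite [z a + _]addrC subrK in low.
have ySum : y - z a = \sum_(a <= k < b) keep (fresh a k) (y - z a).
  by rewrite sum_fresh// cover keepT.
have Lsum : L a (z a) (y - z a) = \sum_(a <= k < b) L a (z a) (keep (fresh a k) (y - z a)).
  by rewrite [in LHS]ySum (big_morph _ (LD a (z a)) L0).
pose e := M * t * X + 2 * (N%:R * v) / t.
have e0 : 0 <= e.
  by rewrite addr_ge0// ?mulr_ge0 ?invr_ge0 ?ler0n ?(ltW t0).
apply: (@le_trans _ _ (\sum_(a <= k < b) (fw_gap k
    + (fresh a k != finset.set0)%:R * e
    + M * t * dot (keep (fresh a k) (y - z a)) (keep (fresh a k) (y - z a))))).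
  apply: (@le_trans _ _ (- L a (z a) (y - z a))); first by lra.
  rewrite Lsum -sumrN !big_nat; apply: ler_sum => k akb.
  have /andP[ak kb] := akb.
  apply: le_trans (fresh_gap a k y t a1 ak Cy _ (dist k akb)) _; first by rewrite t0.
  rewrite lerD2r lerD2l ler_wpM2l ?ler0n// lerD2l ler_wpM2r ?invr_ge0 ?(ltW t0)//.
  rewrite ler_wpM2l// ler_wpM2r// ler_nat (leq_trans _ bN)// leq_sub2r//.
  exact: ltnW.
(* The indicators add up to at most #|U|; by orthogonality the quadratic terms cost a single M t
   X. *)
rewrite !big_split /= -big_distrl -big_distrr /= sum_dot_fresh// cover keepT.
rewrite -natr_sum; apply: lerD; first (apply: lerD => //).
  by rewrite ler_wpM2r// ler_nat count_fresh.
by rewrite ler_wpM2l ?mulr_ge0 ?(ltW t0)//; apply: diamC.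
Qed.

Lemma interval_descent a b y :
  (1 <= a)%N -> (a <= b)%N ->
  (forall k, (a <= k)%N -> F k.+1 (z k.+1) - F k.+1 y <=
     F k (z k) - F k y - beta * fw_gap k + (M * beta ^+ 2 * X + 2 * v)) ->
  F b (z b) - F b y <= F a (z a) - F a y - beta * \sum_(a <= k < b) fw_gap k
    + (b - a)%:R * (M * beta ^+ 2 * X + 2 * v).
Proof.
move=> a1 ab desc; elim: b ab => [|b IH] ab.
  by move: ab a1; rewrite leqn0 => /eqP->.
move: ab; rewrite leq_eqVlt => /orP[/eqP ->|ab].
  by rewrite big_geq// subnn mulr0 subr0 mul0r addr0.
rewrite big_nat_recr//= subSn// -natr1.
have := IH ab; have := desc b ab; lra.
Qed.

Lemma eventual_interval_bound (U : {set {set 'I_n}}) (kk : nat -> nat) (N : nat)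
    (t q r e : R) :
  covering_intervals u kk -> (forall k, (1 <= k)%N -> u k \in U) -> (0 < N)%N ->
  (forall i, (1 <= i)%N -> (kk i.+1 - kk i <= N)%N) ->
  t = Num.min 1 (N%:R * beta) -> 0 < e ->
  N%:R * (M * beta ^+ 2 * X + 2 * v) <= beta * q ->
  #|U|%:R * (M * t * X + 2 * (N%:R * v) / t) + M * t * X <= r ->
  exists K : nat, forall i y, (1 <= i)%N -> (K <= kk i)%N -> C y ->
    F (kk i) (z (kk i)) - F (kk i) y <= (1 + beta) * q + e + r.
Proof.
move=> cov uU N0 kkN tE e0 qN rN; have /andP[b0 b1] := beta01.
have [_ kkS kkC] := cov.
have X0 : 0 <= X by apply: le_trans (step_dir_le 1 isT); apply: dot_ge0.
have c0 : 0 <= M * beta ^+ 2 * X + 2 * v.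
  by apply: addr_ge0; apply: mulr_ge0 => //; apply: mulr_ge0 => //; apply: sqr_ge0.
have q0 : 0 <= q.
  rewrite -(pmulr_rge0 _ b0); apply: le_trans qN; exact: mulr_ge0.
have [K desc] := eventual_descent.
(* Since i <= kk i, starting at [K.+1] ensures both i >= 1 and kk i >= K. *)
have kk_ge i : (K.+1 <= i)%N -> (K <= kk i)%N.
  move=> Ki; apply: leq_trans (covering_intervals_ge _ _ _ cov _); first exact: ltnW.
  exact: leq_trans Ki.
have kk1 i : (K.+1 <= i)%N -> (1 <= kk i)%N.
  move=> Ki; have i1 : (1 <= i)%N by apply: leq_trans Ki.
  exact: leq_trans (covering_intervals_ge _ _ _ cov i1).
have [|||I hI] := @eventually_le_of_descent R _ C
  (fun i y => F (kk i) (z (kk i)) - F (kk i) y)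
  (fun i => \sum_(kk i <= k < kk i.+1) fw_gap k) beta q r e K.+1 b0 q0 e0.
- move=> i Ki; rewrite big_nat; apply: sumr_ge0 => k /andP[ik _].
  by apply: fw_gap_ge0; apply: leq_trans ik; apply: kk1.
- move=> i y Ki Cy; have i1 : (1 <= i)%N by apply: leq_trans Ki.
  apply: le_trans (interval_descent _ _ _ (kk1 i Ki) (ltnW (kkS i i1)) _) _.
    by move=> k ik; apply: desc => //; apply: leq_trans ik; [exact: kk1 | exact: kk_ge].
  rewrite lerD2l; apply: le_trans qN; apply: ler_wpM2r => //.
  by rewrite ler_nat kkN.
- move=> i y Ki Cy; have i1 : (1 <= i)%N by apply: leq_trans Ki.
  apply: le_trans (interval_gap U _ _ _ N t (kk1 i Ki) (ltnW (kkS i i1)) _ _ _ _ _ _) _ => //.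
  + exact: kkN.
  + exact: kkC.
  + by rewrite -addrA lerD2l.
(* Monotonicity of [kk] turns the threshold on i into one on [kk i]. *)
exists (kk I.+1) => i y i1 Ki Cy; apply: hI => //.
rewrite leqNgt; apply/negP => iI.
by move: Ki; rewrite leqNgt (covering_intervals_lt _ _ _ _ cov i1)// ltnS ltnW.
Qed.

End Iteration.

(** * Choice of constants and conclusion *)

Theorem theorem2 (R : realType) (n : nat)
  (* update sets *)
  (U : {set {set 'I_n}}) (hU : admissible U)
  (u : nat -> {set 'I_n}) (hu : forall k, (1 <= k)%N -> u k \in U)
  (kk : nat -> nat) (hkk : covering_intervals u kk)
  (N : nat)
  (hN : is_max [set m | exists2 j, (1 <= j)%N & m = (kk j.+1 - kk j + 1)%N] N)
  (* domain *)
  (D : set 'rV[R]_n) (hDfeas : feasible U D) (hDcomp : compact D)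
  (hDext : extreme_points (convex_hull D) `<=` D)
  (xD : R)
  (hxD : is_max [set r | exists y z, [/\ convex_hull D y, convex_hull D z &
                                         r = norm2 (y - z)]] xD)
  (* objective functions *)
  (F : nat -> 'rV[R]_n -> R)
  (Fu : nat -> forall v : {set 'I_n}, 'rV[R]_#|v| -> R)
  (hF : forall k, (1 <= k)%N -> convex (F k) /\ separable_as U (F k) (Fu k))
  (dF : nat -> 'rV[R]_n -> 'rV[R]_n)
  (hdF : forall k, (1 <= k)%N -> subgradient_choice (F k) (dF k))
  (dFu : nat -> forall v : {set 'I_n}, 'rV[R]_#|v| -> 'rV[R]_#|v|)
  (muF : R)
  (hFu : forall k (v : {set 'I_n}), (1 <= k)%N -> v \in U ->
     [/\ convex (Fu k v), subgradient_choice (Fu k v) (dFu k v) &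
         bounded_curvature [set subvec v z | z in convex_hull D]
           (Fu k v) (dFu k v) muF])
  (* iterates *)
  (beta : R) (hbeta : 0 < beta)
  (x z : nat -> 'rV[R]_n) (hz1 : convex_hull D (z 1%N))
  (hx : forall k, (1 <= k)%N ->
     argmin D (fun y => dot (dF k (z k)) (keep (u k) y)) (x k))
  (hz : forall k, (1 <= k)%N ->
     z k.+1 = z k + beta *: keep (u k) (x k - z k))
  (* step size and variation of the objective; in \bar R, 0^-1 = +oo *)
  (gamma eps' gamma1 : R) (hgamma : 0 < gamma < 1) (heps' : 0 < eps')
  (hbeta_le :
     (beta%:E <= ((1 - gamma) * gamma)%:E *
        Order.min (eps'%:E / (N%:R * muF * xD ^+ 2)%:E) 1)%E)
  (hgamma1 : 0 < gamma1 < gamma / 2)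
  (hvar : forall k y, (1 <= k)%N -> convex_hull D y ->
     `|F k.+1 y - F k y| <= gamma1 * gamma / (2 * N%:R) * beta * eps') :
  exists K : nat, forall i : nat, (1 <= i)%N -> (K <= kk i)%N ->
    forall y, argmin (convex_hull D) (F (kk i)) y ->
      F (kk i) (z (kk i)) - F (kk i) y <= (#|U| + 1)%:R * eps'.
Proof.
have u1U := hu 1%N isT.
have [mu0 _] : bounded_curvature [set subvec (u 1%N) z | z in convex_hull D]
    (Fu 1%N (u 1%N)) (dFu 1%N (u 1%N)) muF by case: (hFu 1%N (u 1%N) isT u1U).
have [g0 g1] := andP hgamma; have [c0 c1] := andP hgamma1.
have [[j1 j1_ge1 NE] Nub] := hN.
have [kk1 kkS kkC] := hkk.
(* The + 1 in the definition of N gives N >= 2, whence beta / t <= 1/2 below. *)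
have N2 : (2 <= N)%N.
  by rewrite NE addn1 ltnS subn_gt0 kkS.
have diam a b : convex_hull D a -> convex_hull D b -> dot (a - b) (a - b) <= xD ^+ 2.
  move=> Ca Cb; have le_xD : norm2 (a - b) <= xD by apply: hxD.2; exists a, b.
  by rewrite -norm2_sqr lerXn2r ?nnegrE ?sqrtr_ge0// (le_trans _ le_xD)// sqrtr_ge0.
have NR2 : (2 : R) <= N%:R by rewrite ler_nat.
have NR0 : (0 : R) < N%:R by rewrite ltr0n ltnW.
pose kap : R := (1 - gamma) * gamma.
have kap0 : 0 <= kap by apply: mulr_ge0; rewrite ?subr_ge0 ltW.
have kap1 : kap <= 1 / 4 by have := sqr_ge0 (gamma - 1 / 2); rewrite /kap; nra.
have X0 : 0 <= xD ^+ 2 by apply: sqr_ge0.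
have p0 : 0 <= N%:R * muF * xD ^+ 2 by exact: mulr_ge0 (mulr_ge0 (ler0n _ _) mu0) X0.
have [beta_kap beta_eps] := step_size_bounds beta kap _ eps' kap0 heps' p0 hbeta_le.
have beta1 : beta < 1 by lra.
pose v : R := gamma1 * gamma / (2 * N%:R) * beta * eps'.
have v0 : 0 <= v.
  apply: mulr_ge0 (ltW heps'); apply: mulr_ge0 (ltW hbeta).
  by apply: divr_ge0; apply: mulr_ge0; rewrite ?ler0n ?ltW.
pose t : R := Num.min 1 (N%:R * beta).
have t0 : 0 < t by rewrite lt_min ltr01 mulr_gt0.
have Nv : N%:R * v = gamma1 * gamma / 2 * beta * eps'.
  by rewrite /v; field; rewrite gt_eqF.
(* By t <= N beta and the step-size bound; the curvature constant M is 2 muF because sets of [U] may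
   overlap. *)
have tX : 2 * muF * t * xD ^+ 2 <= 2 * kap * eps'.
  have : t * (muF * xD ^+ 2) <= N%:R * beta * (muF * xD ^+ 2).
    by apply: ler_wpM2r; [exact: mulr_ge0 | rewrite /t ge_min lexx orbT].
  by nra.
have beta_t : beta / t <= 1 / 2.
  rewrite ler_pdivrMr// /t; case: (leP 1 (N%:R * beta)) => _; first by lra.
  by have := ler_wpM2r (ltW hbeta) NR2; lra.
pose cc : R := gamma1 * gamma.
have cc0 : 0 <= cc by apply: mulr_ge0; apply: ltW.
have cc1 : cc <= gamma ^+ 2 / 2 by rewrite /cc; nra.
have vt : 2 * (N%:R * v) / t <= cc / 2 * eps'.
  rewrite Nv -/cc; have -> : 2 * (cc / 2 * beta * eps') / t = cc * eps' * (beta / t).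
    by field; rewrite gt_eqF.
  have := ler_wpM2l (mulr_ge0 cc0 (ltW heps')) beta_t; lra.
have m1 : (1 : R) <= #|U|%:R by rewrite ler1n card_gt0; apply/set0Pn; exists (u 1%N).
(* beta q covers the errors of an interval: 2 kap from curvature, cc from the variation of F. *)
pose q : R := (2 * kap + cc) * eps'.
(* 2 kap + cc / 2 <= 2 gamma - (7/4) gamma^2, whose maximum 4/7 is at gamma = 4/7; the 1/2 is 2 kap
   at its largest. *)
pose r : R := (#|U|%:R * (4 / 7) + 1 / 2) * eps'.
have replC k : (1 <= k)%N -> replace_closed (convex_hull D) (u k).
  by move=> k1; apply: feasible_replace hDfeas (hu k k1).
pose L k (a : 'rV[R]_n) := sep_dot U (fun w => dFu k w (subvec w a)).
have LD k a : {morph L k a : b c / b + c} by move=> b c; apply: sep_dotD.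
have LZ k a s (b : 'rV[R]_n) : L k a (s *: b) = s * L k a b by apply: sep_dotZ.
have lowF k a b : (1 <= k)%N -> F k a + L k a b <= F k (a + b).
  move=> k1; apply: (separable_lower _ _ _ _ (hF k k1).2).
  by move=> w wU; case: (hFu k w k1 wU).
have upF k (a b : 'rV[R]_n) : (1 <= k)%N -> convex_hull D a -> convex_hull D (a + b) ->
    F k (a + b) <= F k a + L k a b + 2 * muF * dot b b.
  move=> k1 Ca Cab; apply: (separable_upper _ _ _ _ (hF k k1).2 _ _ _ _ hU _ mu0 Ca Cab).
  by move=> w wU; case: (hFu k w k1 wU).
have M0 : 0 <= 2 * muF by lra.
have subg k (y : 'rV[R]_n) : (1 <= k)%N -> F k (z k) + dot (dF k (z k)) (y - z k) <= F k y.
  by move=> k1; apply: hdF.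
have beta01 : 0 < beta < 1 by rewrite hbeta.
have Cx k : (1 <= k)%N -> convex_hull D (x k).
  by move=> /hx[Dx _]; apply: sub_convex_hull.
(* The objective is linear in y, so the points doing no better than [x k] form a half-space
   containing [D], hence its hull. *)
have minx k y : (1 <= k)%N -> convex_hull D y ->
    dot (dF k (z k)) (keep (u k) (x k)) <= dot (dF k (z k)) (keep (u k) y).
  move=> /hx[_ xmin]; move: y.
  apply: (@convex_hull_sub _ _ D [set y | dot (dF k (z k)) (keep (u k) (x k))
    <= dot (dF k (z k)) (keep (u k) y)]); last exact: xmin.
  move=> a b s /= ha hb s01; rewrite !(dot_keepC (u k) (dF k (z k))) in ha hb *.
  by rewrite dotDr dotZr dotDr dotNr; nra.
have kkN i : (1 <= i)%N -> (kk i.+1 - kk i <= N)%N.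
  by move=> i1; apply: leq_trans (leq_addr 1 _) (Nub _ _); exists i.
have qN : N%:R * (2 * muF * beta ^+ 2 * xD ^+ 2 + 2 * v) <= beta * q.
  have := ler_wpM2l (ltW hbeta) beta_eps; rewrite /q /kap /cc.
  by move: Nv; rewrite !expr2; nra.
have rN : #|U|%:R * (2 * muF * t * xD ^+ 2 + 2 * (N%:R * v) / t)
    + 2 * muF * t * xD ^+ 2 <= r.
  have kc : 2 * kap + cc / 2 <= 4 / 7.
    by have := sqr_ge0 (gamma - 4 / 7); rewrite /kap; nra.
  have tX2 : 2 * muF * t * xD ^+ 2 <= 1 / 2 * eps'.
    by apply: le_trans tX _; apply: ler_wpM2r; [exact: ltW | lra].
  have etot : 2 * muF * t * xD ^+ 2 + 2 * (N%:R * v) / t <= 4 / 7 * eps'.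
    apply: le_trans (lerD tX vt) _; rewrite -mulrDl.
    by apply: ler_wpM2r => //; exact: ltW.
  have := ler_wpM2l (ler0n R #|U|) etot; rewrite /r; lra.
(* The budget in units of eps': 5/6 + 1/20 + 1/2 + (4/7) #|U| <= #|U| + 1, because 23/60 <= 3/7 and
   #|U| >= 1. *)
have e0 : 0 < eps' / 20 by lra.
have [K hK] := eventual_interval_bound _ _ _ _ L _ _ _ _ _ _ (convex_hull_segment D)
  diam replC LD LZ lowF upF M0 v0 hvar subg beta01 hz1 Cx minx hz U kk N t q r (eps' / 20)
  hkk hu (ltnW N2) kkN erefl e0 qN rN.
exists K => i i1 Ki y [Cy _]; apply: le_trans (hK i y i1 Ki Cy) _.
(* 2 kap + cc <= 2 gamma - (3/2) gamma^2, with maximum 2/3 at gamma = 2/3. *)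
have qle : q <= 2 / 3 * eps'.
  apply: ler_wpM2r; first exact: ltW.
  by have := sqr_ge0 (gamma - 2 / 3); rewrite /kap; nra.
have bq : (1 + beta) * q <= 5 / 4 * (2 / 3 * eps').
  have q0 : 0 <= q by apply: mulr_ge0; [lra | exact: ltW].
  have : (1 + beta) * q <= 5 / 4 * q by apply: ler_wpM2r => //; lra.
  by lra.
have := ler_wpM2r (ltW heps') m1.
by rewrite natrD /r; lra.
Qed.
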